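(* For every integer $n\ge 1$, the number of one-ball siteswap sequences of length $n$ is $2^n-1$, and the number of one-ball spherical siteswap sequences of length $n$ is also $2^n-1$.
   Context: A siteswap sequence of length (period) $n$ is a sequence $t_1t_2\ldots t_n$ of nonnegative integers such that the residues $i+t_i \pmod n$, $1\le i\le n$, are pairwise distinct, i.e. $\{1,\ldots,n\}=\bigcup_{i=1}^n\{i+t_i \pmod n\}$. Its number of balls is the integer $(t_1+\cdots+t_n)/n$; thus a one-ball siteswap sequence has $t_1+\cdots+t_n=n$. A spherical siteswap sequence of length $n$ is a siteswap sequence $t_1t_2\ldots t_n$ for which, in addition, the values $i+(t_i/2) \pmod n$ (rational numbers taken modulo $n$), over those $i$ with $t_i\ne 0$, are pairwise distinct. Rotations of a sequence are considered distinct, and sequences of length $n$ are counted whether or not $n$ is their minimal period. *)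

(* Defs.v *)
From HB Require Import structures.
From mathcomp Require Import all_boot all_order all_algebra.

Set Implicit Arguments.
Unset Strict Implicit.
Unset Printing Implicit Defensive.

Import GRing.Theory.
Local Open Scope ring_scope.

(* A sequence t_1 ... t_n is t : n.-tuple nat; since 'I_n starts at 0, the     *)
(* entry tnth t i is t_{i+1} and its (1-based) position is i.+1.               *)

Definition siteswap (n : nat) (t : n.-tuple nat) : Prop :=
  injective (fun i : 'I_n => ((i.+1 + tnth t i) %% n)%N).

(* Valued in rat: integrality for siteswap sequences is a theorem, and nat     *)
(* division would silently truncate.                                           *)
Definition nballs (n : nat) (t : n.-tuple nat) : rat :=
  (\sum_(i < n) tnth t i)%N%:R / n%:R.

Definition rat_eqmod (n : nat) (x y : rat) : Prop :=
  exists k : int, x - y = k%:~R * n%:R.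

Definition spherical_siteswap (n : nat) (t : n.-tuple nat) : Prop :=
  siteswap t /\
  forall i j : 'I_n, tnth t i <> 0%N -> tnth t j <> 0%N -> i <> j ->
    ~ rat_eqmod n (i.+1%:R + (tnth t i)%:R / 2%:R)
                  (j.+1%:R + (tnth t j)%:R / 2%:R).

(* Main.v *)
Require Import Defs.
From mathcomp Require Import all_boot all_order all_algebra.
From mathcomp Require Import zify.
From mathcomp Require Import boolp classical_sets functions cardinality.

(** In a one-ball siteswap the ball visits exactly the positions i with
    t_i <> 0.  The map i |-> i + t_i is a permutation fixing the other
    positions, so it preserves the support S and t_i is at least the distance
    (gap) from i to the cyclically next element of S.  The gaps around the circle
    add up to n, and so do the t_i, whence t_i is the gap.  Thus t |-> S is a
    bijection onto the nonempty subsets of Z/n.  The point i + t_i/2 is the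
    midpoint of the arc from i to the next element of S; these arcs do not
    overlap, so every one-ball siteswap is spherical. *)

Section Gaps.

Import GRing.Theory Num.Theory.
Local Open Scope ring_scope.

Variable m : nat.
Implicit Types (S : {set 'I_m.+1}) (i j x : 'I_m.+1) (t : m.+1.-tuple nat).

(** * Gaps of a subset of Z/n *)

Lemma inZpD a b : inZp (a + b) = inZp a + inZp b :> 'I_m.+1.
Proof. by apply: val_inj; rewrite /= modnDm. Qed.

Lemma inZp_modulus : inZp m.+1 = 0 :> 'I_m.+1.
Proof. by apply: val_inj; rewrite /= modnn. Qed.

Lemma inZp0 : inZp 0 = 0 :> 'I_m.+1.
Proof. by apply: val_inj; rewrite /= mod0n. Qed.

Lemma inZpB a b : (b <= a)%N -> inZp (a - b) = inZp a - inZp b :> 'I_m.+1.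
Proof. by move=> ba; rewrite -{2}(subnK ba) inZpD addrK. Qed.

(* The value is m.+2 when S is empty; only x in S matters below. *)
Definition gap S x : nat :=
  (find (fun k => x + inZp k.+1 \in S) (iota 0 m.+1)).+1.

Lemma gap_le S x k : (0 < k)%N -> x + inZp k \in S -> (gap S x <= k)%N.
Proof.
case: k => // k _ xS; rewrite /gap ltnS.
have [km|mk] := ltnP k m.+1; last first.
  apply: leq_trans mk.
  have := find_size (fun k => x + inZp k.+1 \in S) (iota 0 m.+1).
  by rewrite size_iota.
rewrite leqNgt; apply/negP => /(before_find 0%N).
by rewrite nth_iota // xS.
Qed.

Lemma gap_mem S x : x \in S -> x + inZp (gap S x) \in S.
Proof.
move=> xS; have hasS : has (fun k => x + inZp k.+1 \in S) (iota 0 m.+1).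
  (* The search succeeds at the latest after [m.+1] steps, a full turn back to [x]. *)
  by apply/hasP; exists m; rewrite ?mem_iota //= inZp_modulus addr0.
have := nth_find 0%N hasS; rewrite nth_iota //.
by move: hasS; rewrite has_find size_iota.
Qed.

(** Serves the double count in [sum_gap]: for a fixed [x], the least backward distance [b] to [S] is
    the only index that contributes. *)
Lemma last_visit S x : S != finset.set0 ->
  exists2 b : 'I_m.+1, x - inZp b \in S
    & forall k, (k < b)%N -> x - inZp k \notin S.
Proof.
case/set0Pn => y yS.
have exb : exists k, x - inZp k \in S.
  by exists (x - y : 'I_m.+1); rewrite valZpK subKr.
case: (ex_minnP exb) => b bS bmin.
have bm : (b < m.+1)%N.
  by apply: leq_ltn_trans (bmin (val (x - y)) _) (ltn_ord _); rewrite valZpK subKr.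
by exists (Ordinal bm) => // k kb; apply/negP => /bmin; rewrite leqNgt kb.
Qed.

Lemma gap_le_modulus S x : x \in S -> (gap S x <= m.+1)%N.
Proof. by move=> xS; apply: gap_le; rewrite // inZp_modulus addr0. Qed.

(* Double count the pairs (y, k) with y in S and k < gap S y by the position
   x = y + k: each x is reached once, from the last element of S before it. *)
Lemma sum_gap S : S != finset.set0 -> (\sum_(x in S) gap S x = m.+1)%N.
Proof.
move=> S0.
(* Restricting to [k < m.+1] loses nothing, since the gap is at most a full turn. *)
have gapE y : y \in S -> gap S y = (\sum_(k < m.+1) (k < gap S y))%N.
  move=> /gap_le_modulus yS.
  rewrite -(big_mkord xpredT (fun k => (k < gap S y : nat)%N)).
  rewrite (big_cat_nat (leq0n _) yS) //= [X in (_ + X)%N]big_nat.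
  rewrite [X in (_ + X)%N]big1 => [|k /andP[yk _]]; last by rewrite ltnNge yk.
  rewrite big_nat (eq_bigr (fun=> 1%N)) => [|k /andP[_ ->]//].
  by rewrite -big_nat sum_nat_const_nat subn0 muln1 addn0.
rewrite (eq_bigr _ gapE) exchange_big /=.
transitivity (\sum_(k < m.+1) \sum_x
    ((x - inZp k \in S)%R && (k < gap S (x - inZp k)%R)))%N.
  apply: eq_bigr => k _; rewrite big_mkcond /=.
  rewrite (reindex_inj (addIr (- inZp k))) /=.
  by apply: eq_bigr => x _; case: (_ \in S).
rewrite exchange_big /= -[RHS]card_ord -sum1_card; apply: eq_bigr => x _.
have [b bS bmin] := last_visit _ x S0.
(* Indices below [b] miss [S]. For [k > b], the element [x - b] comes [k - b] steps after [x - k],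
   so the gap at [x - k] is at most [k - b]. *)
rewrite (bigD1 b) //= bS big1 ?addn0 => [|k kb]; last first.
  have [kS /=|//] := boolP (_ \in S).
  have {kb} bk : (b < k)%N.
    rewrite ltn_neqAle eq_sym kb leqNgt; apply/negP => /bmin.
    by rewrite kS.
  rewrite ltnNge (@leq_trans (k - b)) ?leq_subr // gap_le ?subn_gt0 //.
  by rewrite inZpB 1?ltnW // addrA subrK.
(* A gap at [x - b] of at most [b] would put an element of [S] fewer than [b] steps behind [x]. *)
rewrite ltnNge; case: leqP => // gb.
have := gap_mem _ _ bS; rewrite -addrA [- _ + _]addrC -opprB -inZpB // => hS.
have/negP[] // : x - inZp (b - gap S (x - inZp b)) \notin S.
by apply: bmin; rewrite ltn_subLR // -{1}[b : nat]add0n ltn_add2r.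
Qed.

(** * Passing between subsets and sequences *)

Definition gap_tuple S : m.+1.-tuple nat :=
  [tuple if i \in S then gap S i else 0%N | i < m.+1].

Definition supp t : {set 'I_m.+1} := [set i | tnth t i != 0%N]%SET.

Lemma supp_gap_tuple S : supp (gap_tuple S) = S.
Proof. by apply/setP => i; rewrite inE tnth_mktuple; case: ifP. Qed.

(** The shift to 1-based positions is common to both sides and cancels modulo n. *)
Lemma siteswapE t : siteswap t <-> injective (fun i => i + inZp (tnth t i)).
Proof.
have E i j : ((i.+1 + tnth t i) %% m.+1 = (j.+1 + tnth t j) %% m.+1)%N <->
    i + inZp (tnth t i) = j + inZp (tnth t j).
  split=> [/eqP|/(congr1 val)/eqP] /=.
    rewrite !addSn -![(_ + _).+1]add1n eqn_modDl => /eqP h.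
    by apply: val_inj; rewrite /= !modnDmr.
  by rewrite !modnDmr -(eqn_modDl 1) !add1n => /eqP.
by split=> h i j /E/h.
Qed.

Lemma gap_tuple_siteswap S : siteswap (gap_tuple S).
Proof.
apply/siteswapE => i j; rewrite !tnth_mktuple.
case: ifP => iS; case: ifP => jS; rewrite ?inZp0 ?addr0 //; last 2 first.
- by move=> e; move: jS; rewrite -e gap_mem.
- by move=> e; move: iS; rewrite e gap_mem.
(* If the landings agree, [i] lies [gap S j - gap S i] steps after [j]. A positive difference would
   place an element of [S] inside the gap at [j]. *)
wlog ij : i j iS jS / (gap S i <= gap S j)%N => [H|] e.
  by case/orP: (leq_total (gap S i) (gap S j)) => /H; [apply|move=> <-].
have iE : i = j + inZp (gap S j - gap S i) by rewrite inZpB // addrA -e addrK.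
have [gij|gij] := posnP (gap S j - gap S i).
  by rewrite iE gij inZp0 addr0.
have := @gap_le S j _ gij; rewrite -iE => /(_ iS).
by rewrite leqNgt ltn_subrL.
Qed.

Lemma siteswap_supp t i : siteswap t -> i \in supp t ->
  i + inZp (tnth t i) \in supp t.
Proof.
move=> /siteswapE inj_t iS; apply: contraLR iS; rewrite !inE !negbK => /eqP t0.
suff /inj_t e : i + inZp (tnth t i) + inZp (tnth t (i + inZp (tnth t i)))
    = i + inZp (tnth t i) by rewrite -{1}e t0.
by rewrite t0 inZp0 addr0.
Qed.

Lemma nballs1E t : nballs t = 1 <-> (\sum_(i < m.+1) tnth t i)%N = m.+1.
Proof.
rewrite /nballs; split=> [/(canRL (mulfVK _)) h|->]; last by rewrite divff ?pnatr_eq0.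
by apply/eqP; rewrite -(eqr_nat rat) h ?pnatr_eq0 // mul1r.
Qed.

Lemma sum_supp t : (\sum_i tnth t i = \sum_(i in supp t) tnth t i)%N.
Proof.
rewrite [RHS]big_mkcond; apply: eq_bigr => i _; rewrite inE.
by case: eqP.
Qed.

Lemma supp_neq0 t : nballs t = 1 -> supp t != finset.set0.
Proof.
move=> /nballs1E; rewrite sum_supp; case: eqP => // ->.
by rewrite big_set0.
Qed.

Lemma gap_tuple_nballs S : S != finset.set0 -> nballs (gap_tuple S) = 1.
Proof.
move=> S0; apply/nballs1E; rewrite sum_supp supp_gap_tuple -[RHS](sum_gap _ S0).
by apply: eq_bigr => i iS; rewrite tnth_mktuple iS.
Qed.

Lemma one_ball_siteswapE t : siteswap t -> nballs t = 1 ->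
  t = gap_tuple (supp t).
Proof.
move=> tS t1; have le_gap i : i \in supp t -> (gap (supp t) i <= tnth t i)%N.
  move=> iS; apply: gap_le; last exact: siteswap_supp.
  by move: iS; rewrite inE lt0n.
(* Both sums equal [m.+1], so the termwise inequality is an equality throughout. *)
have [_ /esym] := leqif_sum (fun i iS => leqif_eq (le_gap i iS)).
rewrite sum_gap ?supp_neq0 // -sum_supp (iffLR (nballs1E t)) // eqxx.
move=> /forall_inP gapE; apply: eq_from_tnth => i; rewrite tnth_mktuple.
case: ifPn => [/gapE/eqP-> //|]; by rewrite inE negbK => /eqP.
Qed.

Lemma one_ball_siteswap_spherical t :
  siteswap t -> nballs t = 1 -> spherical_siteswap t.
Proof.
move=> tS t1; split=> // i j ti0 tj0 ij [k].
wlog ltij : i j ti0 tj0 {ij} k / (i < j)%N => [H|].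
  have [|ji|/val_inj//] := ltngtP i j; first exact: H ti0 tj0 k.
  by move=> e; apply: (H j i tj0 ti0 (- k) ji); rewrite -opprB e intrN mulNr.
have tE l : tnth t l <> 0%N -> (l \in supp t) /\ tnth t l = gap (supp t) l.
  move=> /eqP tl0; have lS : l \in supp t by rewrite inE.
  by split=> //; rewrite {1}(one_ball_siteswapE _ tS t1) tnth_mktuple lS.
have [iS tiE] := tE i ti0; have [jS tjE] := tE j tj0.
have ti_le : (tnth t i <= j - i)%N.
  rewrite tiE gap_le ?subn_gt0 // inZpB ?valZpK 1?addrC ?subrK //.
  exact: ltnW.
(* The way from [j] forward to [i] wraps around zero. *)
have tj_le : (tnth t j <= m.+1 - (j - i))%N.
  rewrite tjE gap_le ?subn_gt0 ?(leq_ltn_trans (leq_subr _ _)) //.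
  rewrite inZpB ?(leq_trans (leq_subr _ _)) 1?ltnW // inZp_modulus sub0r.
  by rewrite inZpB ?valZpK ?opprB 1?addrC ?subrK // ltnW.
move=> /(congr1 ( *%R^~ 2%:R)); rewrite mulrBl !mulrDl !divfK // => e.
have {}e : (i.+1%:Z * 2 + tnth t i) - (j.+1%:Z * 2 + tnth t j) = k * m.+1%:Z * 2.
  apply: (@intr_inj rat); rewrite intrB !intrM !intrD !intrM.
  exact: e.
have jm := ltn_ord j.
(* By the two bounds, the left side of [e] lies strictly between [-2 * m.+1] and 0, which excludes
   every multiple of [2 * m.+1]. *)
have [k0|[k0|k0]] : k <= -1 \/ k = 0 \/ 1 <= k by lia.
- have : k * m.+1%:Z <= - m.+1%:Z by nia.
  lia.
- by move: e; rewrite k0; lia.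
- have : m.+1%:Z <= k * m.+1%:Z by nia.
  lia.
Qed.

End Gaps.

(** * Counting *)

Local Open Scope classical_set_scope.

Lemma card_eq_seq (T : eqType) (s : seq T) : uniq s ->
  ([set` s] #= `I_(size s))%card.
Proof.
case: s => [|x s] us; first by rewrite set_nil II0 card_eq00.
have -> : [set` x :: s] = nth x (x :: s) @` `I_(size (x :: s)).
  apply/seteqP; split=> [y /= /(nthP x)[k ks <-]|_ [k /= ks <-]]; first by exists k.
  exact: mem_nth.
apply: inj_card_eq => k l; rewrite !inE => ks ls /eqP.
by rewrite nth_uniq // => /eqP.
Qed.

Lemma card_nonempty_sets (T : finType) :
  #|[set S : {set T} | S != finset.set0]%SET| = (2 ^ #|T| - 1)%N.
Proof.
have := cardsC1 (finset.set0 : {set T}).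
rewrite -cardsT -powersetT card_powerset cardsT subn1 => <-.
by apply: eq_card => S; rewrite !inE.
Qed.

Lemma card_one_ball_siteswap (m : nat) :
  ([set t : m.+1.-tuple nat | siteswap t /\ nballs t = 1%R]
     #= `I_(2 ^ m.+1 - 1)%N)%card.
Proof.
set P := [set S : {set 'I_m.+1} | S != finset.set0]%SET.
have -> : [set t : m.+1.-tuple nat | siteswap t /\ nballs t = 1%R]
    = gap_tuple m @` [set` enum P].
  apply/seteqP; split=> [t /= [tS t1]|_ [S /= + <-]].
    exists (supp m t); first by rewrite /= mem_enum inE supp_neq0.
    exact/esym/one_ball_siteswapE.
  rewrite mem_enum inE => S0; split; first exact: gap_tuple_siteswap.
  exact: gap_tuple_nballs.
have gap_inj : injective (gap_tuple m) by apply: can_inj (supp_gap_tuple m).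
rewrite (card_eql (inj_card_eq (in2W gap_inj))).
have := card_nonempty_sets 'I_m.+1; rewrite card_ord cardE => <-.
exact/card_eq_seq/enum_uniq.
Qed.

Theorem mainTheorem3 (n : nat) (hn : (1 <= n)%N) :
  ([set t : n.-tuple nat | siteswap t /\ nballs t = 1%R]
     #= `I_(2 ^ n - 1)%N)%card
  /\
  ([set t : n.-tuple nat | spherical_siteswap t /\ nballs t = 1%R]
     #= `I_(2 ^ n - 1)%N)%card.
Proof.
case: n hn => // m _; split; first exact: card_one_ball_siteswap.
(* Sphericality is automatic for one ball, so both sets coincide. *)
rewrite (_ : mkset _ = [set t | siteswap t /\ nballs t = 1%R]).
  exact: card_one_ball_siteswap.
apply/seteqP; split=> t /= [tS t1]; first by case: tS.
by split=> //; apply: one_ball_siteswap_spherical.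
Qed.
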